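(* Let $\mathrm L$ be a coatomic logic with a simple local IL, let $\Gamma$ be a set of formulas and $\overline\varphi$ a non-empty tuple of formulas. Then the rule $\Gamma\vdash\overline\varphi$ is antiadmissible in $\mathrm L$ if and only if for each $\Delta\subseteq\mathrm{Fm}\,\mathrm L$ $$\overline\varphi,\Delta\vdash_{\mathrm L}\varnothing\implies\Gamma,\Delta\vdash_{\mathrm L}\varnothing.$$ Moreover, we may restrict $\Delta$ to range over the simple theories of $\mathrm L$ (i.e. antiadmissibility of the rule is also equivalent to this implication holding for each simple theory $\Delta$ of $\mathrm L$).
   Context: A logic $\mathrm{L}$ is given by an infinite set of variables $\mathrm{Var}\,\mathrm L$, the absolutely free algebra of formulas $\mathbf{Fm}\,\mathrm L$ over it in some signature (with underlying set $\mathrm{Fm}\,\mathrm{L}$), and a relation $\Gamma \vdash_{\mathrm{L}} \varphi$ between sets of formulas and formulas which is reflexive, monotone, closed under cut (if $\Gamma \vdash_{\mathrm L} \varphi$ for all $\varphi\in\Phi$ and $\Phi \vdash_{\mathrm L} \psi$, then $\Gamma \vdash_{\mathrm L} \psi$) and structural (closed under substitutions, i.e. endomorphisms of $\mathbf{Fm}\,\mathrm L$). $\Gamma\vdash_{\mathrm L}\Phi$ means $\Gamma\vdash_{\mathrm L}\varphi$ for all $\varphi\in\Phi$. A theory is a set of formulas closed under $\vdash_{\mathrm L}$; a theory is simple if it is maximal among theories different from $\mathrm{Fm}\,\mathrm L$. $\mathrm L$ is coatomic if every theory different from $\mathrm{Fm}\,\mathrm L$ is included in a simple theory. $\Gamma\vdash_{\mathrm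 L}\varnothing$ means that $\Gamma$ is an antitheorem of $\mathrm L$: for each algebra $\mathbf A$, each $F\subsetneq A$ such that $g^{-1}[F]$ is a theory of $\mathrm L$ for every homomorphism $g\colon\mathbf{Fm}\,\mathrm L\to\mathbf A$, and each homomorphism $h\colon\mathbf{Fm}\,\mathrm L\to\mathbf A$, $h[\Gamma]\not\subseteq F$. Equivalently, $\sigma[\Gamma]\vdash_{\mathrm L}\mathrm{Fm}\,\mathrm L$ for each substitution $\sigma$. $\mathrm L$ has a simple local IL (the arity is immaterial; the unary form is stated here) if there is a family $\Psi_1$ of sets of formulas $I(p)$ in one variable $p$ such that $\varphi,I(\varphi)\vdash_{\mathrm L}\mathrm{Fm}\,\mathrm L$ for each formula $\varphi$ and each $I\in\Psi_1$, and for each simple theory $T$ and formula $\varphi$: if $T,\varphi\vdash_{\mathrm L}\mathrm{Fm}\,\mathrm L$, then $T\vdash_{\mathrm L}I(\varphi)$ for some $I\in\Psi_1$. Here $I(\varphi)$ is the result of substituting $\varphi$ for $p$. A rule $\Gamma\vdash\overline\varphi$ is antiadmissible in $\mathrm L$ if for each substitution $\sigma$ and each $\Delta\subseteq\mathrm{Fm}\,\mathrm L$: if $\sigma(\overline\varphi),\Delta\vdash_{\mathrm L}\mathrm{Fm}\,\mathrm L$, then $\sigma[\Gamma],\Delta\vdash_{\mathrm L}\mathrm{Fm}\,\mathrm L$. *)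

(* Defs.v *)
From mathcomp Require Import all_boot.
From mathcomp Require Import boolp classical_sets functions cardinality.

Set Implicit Arguments.
Unset Strict Implicit.
Unset Printing Implicit Defensive.

Local Open Scope classical_set_scope.

Record signature : Type := Signature {
  op : Type;
  arity : op -> nat }.

Record algebra (S : signature) : Type := Algebra {
  carrier :> Type;
  interp : forall o : op S, ('I_(arity o) -> carrier) -> carrier }.

Definition hom (S : signature) (A B : algebra S) (h : A -> B) : Prop :=
  forall (o : op S) (a : 'I_(arity o) -> A),
    h (interp a) = interp (fun i => h (a i)).

Inductive term (S : signature) (V : Type) : Type :=
| TVar (v : V)
| TApp (o : op S) (ts : 'I_(arity o) -> term S V).

Definition term_algebra (S : signature) (V : Type) : algebra S :=
  Algebra (@TApp S V).

Fixpoint vars (S : signature) (V : Type) (t : term S V) : set V :=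
  match t with
  | TVar v => [set v]
  | TApp _ ts => [set v | exists i, vars (ts i) v]
  end.

Fixpoint instantiate (S : signature) (V : Type) (p : V) (u t : term S V) :
    term S V :=
  match t with
  | TVar v => if `[< v = p >] then u else TVar S v
  | TApp _ ts => TApp (fun i => instantiate p u (ts i))
  end.

Record logic : Type := Logic {
  sig : signature;
  Var : Type;
  Var_infinite : infinite_set [set: Var];
  entails : set (term sig Var) -> term sig Var -> Prop;
  entails_refl : forall (G : set (term sig Var)) f, G f -> entails G f;
  entails_mono : forall (G D : set (term sig Var)) f,
    G `<=` D -> entails G f -> entails D f;
  entails_cut : forall (G P : set (term sig Var)) f,
    (forall g, P g -> entails G g) -> entails P f -> entails G f;
  entails_struct :
    forall s : term_algebra sig Var -> term_algebra sig Var, hom s ->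
    forall (G : set (term sig Var)) f, entails G f -> entails (s @` G) (s f) }.

Definition Fm (L : logic) : algebra (sig L) := term_algebra (sig L) (Var L).

Definition substitution (L : logic) (s : Fm L -> Fm L) : Prop := hom s.

Definition entails_set (L : logic) (G P : set (Fm L)) : Prop :=
  forall f, P f -> entails G f.

Definition theory (L : logic) (T : set (Fm L)) : Prop :=
  forall f, entails T f -> T f.

Definition simple_theory (L : logic) (T : set (Fm L)) : Prop :=
  [/\ theory T, T <> setT &
    forall T' : set (Fm L), theory T' -> T' <> setT -> T `<=` T' -> T' = T].

Definition coatomic (L : logic) : Prop :=
  forall T : set (Fm L), theory T -> T <> setT ->
    exists2 T' : set (Fm L), simple_theory T' & T `<=` T'.

Definition filter_on (L : logic) (A : algebra (sig L)) (F : set A) : Prop :=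
  forall g : Fm L -> A, hom g -> theory (g @^-1` F).

(* Formal counterpart of G |- empty set: no proper filter contains an image
   of G. *)
Definition antitheorem (L : logic) (G : set (Fm L)) : Prop :=
  forall (A : algebra (sig L)) (F : set A), F <> setT -> filter_on F ->
  forall h : Fm L -> A, hom h -> ~ (h @` G `<=` F).

(* Psi is a family of sets of formulas in the single variable p (constants
   allowed), and I(f) is the image of I under p := f. *)
Definition simple_local_IL (L : logic) : Prop :=
  exists (p : Var L) (Psi : set (set (Fm L))),
  [/\ forall I, Psi I -> forall f, I f -> vars f `<=` [set p],
      forall (f : Fm L) I, Psi I ->
        entails_set (f |` (instantiate p f @` I)) setT &
      forall (T : set (Fm L)) (f : Fm L), simple_theory T ->
        entails_set (T `|` [set f]) setT ->
        exists2 I, Psi I & entails_set T (instantiate p f @` I)].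

(* Tuples of formulas are families over an arbitrary index type K, so that
   both finite and infinite tuples are covered. *)
Definition antiadmissible (L : logic) (G : set (Fm L))
    (K : Type) (phi : K -> Fm L) : Prop :=
  forall (s : Fm L -> Fm L) (D : set (Fm L)), substitution s ->
    entails_set (range (fun k => s (phi k)) `|` D) setT ->
    entails_set ((s @` G) `|` D) setT.

(* Main.v *)
(** For every substitution [s], the preimage [s^-1[T]] of a theory is a theory.
    If antiadmissibility fails at [s] and [D], coatomicity yields a simple
    theory [T] containing [s[G]] and [D] with [s(phi_k)] outside [T] for some
    [k], so [T] contains [I(s(phi_k)) = s[I(phi_k)]] for some [I] of the local
    IL. Any simple [T'] above [s^-1[T]] then contains [G] and [I(phi_k)]; the
    latter makes [phi, T'] an antitheorem, whereas [G, T'] is just [T']. *)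
Require Import Defs.
From mathcomp Require Import all_boot.
From mathcomp Require Import boolp classical_sets functions cardinality.

Local Open Scope classical_set_scope.

(** Hilbert's hotel: on a copy [f] of the natural numbers inside [V], [e] shifts by one, and it
    fixes everything else, so [f 0] is missed. *)
Lemma infinite_inj_not_surj (V : Type) : infinite_set [set: V] ->
  exists (e : V -> V) (y : V), injective e /\ forall v, e v <> y.
Proof.
move=> /infiniteP /card_leP [f0].
pose f (n : nat) : V := val (f0 (to_setT n)).
have finj : injective f.
  move=> m n /val_inj /(@inj _ _ _ f0); rewrite !inE => /(_ I I).
  by move=> /(congr1 val).
pose in_range v := exists n, f n = v.
pose e v := if pselect (in_range v) is left H then f (projT1 (cid H)).+1 else v.
have eP v : (exists n, v = f n /\ e v = f n.+1) \/ (~ in_range v /\ e v = v).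
  rewrite /e; case: pselect => H; last by right.
  by left; case: (cid H) => n /= fn; exists n.
exists e, (f 0); split.
- move=> u v; case: (eP u) => [[m [-> ->]]|[nu ->]];
    case: (eP v) => [[n [-> ->]]|[nv ->]] //.
  + by move=> /finj [->].
  + by move=> E; case: nv; exists m.+1.
  + by move=> E; case: nu; exists n.+1.
- move=> v; case: (eP v) => [[n [_ ->]]|[nv ->]]; first by move=> /finj.
  by move=> E; case: nv; exists 0.
Qed.

Fixpoint eval (S : signature) (V : Type) (A : algebra S) (g : V -> A)
    (t : term S V) : A :=
  match t with
  | TVar v => g v
  | TApp o ts => @interp S A o (fun i => eval S V A g (ts i))
  end.
Arguments eval {S V A}.

Lemma hom_eval (S : signature) (V : Type) (A : algebra S) (g : V -> A) :
  hom (A := term_algebra S V) (eval g).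
Proof. by []. Qed.

Lemma hom_ext (S : signature) (V : Type) (A : algebra S)
    (g h : term_algebra S V -> A) : hom g -> hom h ->
  (forall v, g (TVar S v) = h (TVar S v)) -> g = h.
Proof.
move=> hg hh E; apply/funext; elim=> [//|o ts IH].
by rewrite (hg o ts) (hh o ts); congr interp; apply/funext.
Qed.

Lemma hom_comp (S : signature) (A B C : algebra S) (g : A -> B) (h : B -> C) :
  hom g -> hom h -> hom (h \o g).
Proof. by move=> hg hh o a; rewrite /= hg hh. Qed.

(** Serves to turn s(I(phi)) into I(s(phi)): since [p] is the only variable of [t], all variables
    left after instantiation lie inside copies of [u]. *)
Lemma hom_instantiate (S : signature) (V : Type) (p : V) (u t : term S V)
    (s : term_algebra S V -> term_algebra S V) :
  hom s -> vars t `<=` [set p] -> s (instantiate p u t) = instantiate p (s u) t.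
Proof.
move=> hs; elim: t => [v /(_ v erefl) /= ->|o ts IH /= sub].
  by rewrite asboolT.
rewrite [LHS](hs o); congr TApp; apply/funext => i; apply: IH => v vi.
by apply: sub; exists i.
Qed.

Section Logic.
Variable L : logic.
Implicit Types (G D T : set (Fm L)) (s : Fm L -> Fm L).

Lemma entails_setS G D (P : set (Fm L)) :
  G `<=` D -> entails_set G P -> entails_set D P.
Proof. by move=> GD GP f /GP; apply: entails_mono. Qed.

Lemma consequences_theory G : theory (entails G).
Proof. by move=> f; apply: entails_cut. Qed.

Lemma theory_preimage s T : hom s -> theory T -> theory (s @^-1` T).
Proof.
move=> hs thT f /(entails_struct hs) H; apply: thT; apply: entails_mono H.
by move=> _ [g Tg <-].
Qed.

Lemma theory_explosive T : theory T -> entails_set T setT -> T = setT.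
Proof. by move=> thT TT; apply/seteqP; split=> // f _; apply/thT/TT. Qed.

Lemma consistent_sub_simple G : coatomic L -> ~ entails_set G setT ->
  exists2 T, simple_theory T & G `<=` T.
Proof.
move=> coat Gcons.
have [|T sT GT] := coat _ (consequences_theory G).
  by move=> E; apply: Gcons => f _; rewrite -[entails G f]/((entails G) f) E.
by exists T => // f Gf; apply/GT/entails_refl.
Qed.

(** Otherwise the consequences of [T] and [f] would form a proper theory above [T], which by
    maximality is [T] itself. *)
Lemma simple_theory_explosive T f : simple_theory T -> ~ T f ->
  entails_set (T `|` [set f]) setT.
Proof.
move=> [_ _ maxT] nTf; apply: contrapT => nex; apply: nTf.
rewrite -(maxT _ (consequences_theory (T `|` [set f]))).
- by apply: entails_refl; right.
- by move=> E; apply: nex => g _; rewrite -[entails _ g]/((entails _) g) E.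
- by move=> g Tg; apply: entails_refl; left.
Qed.

Lemma antitheoremP G :
  antitheorem G <-> forall s, substitution s -> entails_set (s @` G) setT.
Proof.
split=> [anti s hs|expl A F Fproper filF h hh hGF].
  (* If s[G] did not explode, its consequences would be a proper filter on the formula algebra
     itself, refuting [anti] at the homomorphism [s]. *)
  apply: contrapT => nex; apply: (anti (Fm L) (entails (s @` G)) _ _ s hs).
  - by move=> E; apply: nex => g _; rewrite -[entails _ g]/((entails _) g) E.
  - by move=> g hg; apply: theory_preimage => //; apply: consequences_theory.
  - by move=> f; apply: entails_refl.
(* Rename the variables so as to free one variable [y], which [g] can send
   anywhere while still agreeing with [h] on the renamed [G]. *)
have [e [y [einj ey]]] := infinite_inj_not_surj _ (@Var_infinite L).
apply: Fproper; apply/seteqP; split=> // a _.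
(* On the range of [e], undo [e] and apply [h]; the default value [a] is what [y] receives. *)
pose gv v := if pselect (exists x, e x = v) is left H
             then h (TVar (sig L) (projT1 (cid H))) else a.
have gve x : gv (e x) = h (TVar _ x).
  rewrite /gv; case: pselect => [H|[]]; last by exists x.
  by case: (cid H) => x' /= /einj ->.
have gvy : gv y = a.
  by rewrite /gv; case: pselect => // H; case: (cid H) => x exy; case: (ey x).
pose s : Fm L -> Fm L := eval (fun v => TVar _ (e v) : Fm L).
have hs : hom s by apply: hom_eval.
have gsE : eval gv \o s = h.
  by apply: hom_ext hh _ => //; apply: hom_comp => //; apply: hom_eval.
(* The preimage of [F] under [eval gv] is a theory containing s[G], which explodes; hence it
   contains [y], and [F] contains [a]. *)
rewrite -gvy; apply: (filF (eval gv) (hom_eval _ _ _ gv) (TVar _ y)).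
apply: entails_mono (expl s hs (TVar _ y) I) => _ [f Gf <-].
by rewrite /preimage /= -[eval gv (s f)]/((eval gv \o s) f) gsE; apply: hGF;
  exists f.
Qed.

Lemma antitheorem_explosive G : antitheorem G -> entails_set G setT.
Proof.
move=> /antitheoremP anti; rewrite -[G]image_id.
by apply: anti => o a.
Qed.

(** At each substitution [s], antiadmissibility is used with the context s[D]. *)
Lemma antiadmissible_antitheorem G (K : Type) (phi : K -> Fm L) D :
  antiadmissible G phi ->
  antitheorem (range phi `|` D) -> antitheorem (G `|` D).
Proof.
move=> adm /antitheoremP anti; apply/antitheoremP => s hs.
rewrite image_setU; apply: adm => //.
by have := anti s hs; rewrite image_setU image_comp.
Qed.

Lemma simple_antitheorem_antiadmissible G (K : Type) (phi : K -> Fm L) :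
  coatomic L -> simple_local_IL L ->
  (forall D, simple_theory D ->
     antitheorem (range phi `|` D) -> antitheorem (G `|` D)) ->
  antiadmissible G phi.
Proof.
move=> coat [p [Psi [Psivars Psiexpl Psiloc]]] anti s D hs expl.
apply: contrapT => nexpl; have [T sT] := consistent_sub_simple _ coat nexpl.
rewrite subUset => -[GT DT]; have [thT Tproper _] := sT.
(* If every s(phi_k) were in [T], then [expl] would make [T] inconsistent, as [D] is included in
   [T]. *)
have [k nTk] : exists k, ~ T (s (phi k)).
  apply: contrapT => /forallNP allT; apply/Tproper/theory_explosive => //.
  apply: entails_setS expl; rewrite subUset; split=> // _ [k _ <-].
  by apply: contrapT; apply: allT.
have [I PsiI TI] := Psiloc _ _ sT (simple_theory_explosive _ _ sT nTk).
have thP := theory_preimage _ _ hs thT.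
(* [phi k] lies outside s^-1[T]. [Logic.I] proves [True], since [I] now names a member of [Psi]. *)
have Pcons : ~ entails_set (s @^-1` T) setT.
  by move=> /(_ (phi k) Logic.I) /thP.
have [T' sT' PT'] := consistent_sub_simple _ coat Pcons.
have [thT' T'proper _] := sT'.
have IT' : instantiate p (phi k) @` I `<=` T'.
  move=> _ [f If <-]; apply: PT'; rewrite /preimage /=.
  rewrite hom_instantiate //; last exact: Psivars If.
  by apply/thT/TI; exists f.
have phiT' : antitheorem (range phi `|` T').
  (* For every substitution [t], t[T'] contains t[I(phi_k)] = I(t(phi_k)), which explodes together
     with t(phi_k). *)
  apply/antitheoremP => t ht; apply: entails_setS (Psiexpl (t (phi k)) _ PsiI).
  move=> g [->|[f If <-]]; first by exists (phi k) => //; left; exists k.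
  exists (instantiate p (phi k) f); first by right; apply: IT'; exists f.
  by rewrite hom_instantiate //; apply: Psivars If.
apply/T'proper/theory_explosive => //.
apply: entails_setS (antitheorem_explosive _ (anti _ sT' phiT')).
by rewrite subUset; split=> // f Gf; apply/PT'/GT; exists f.
Qed.

End Logic.

Theorem proposition4p11 (L : logic) (Hcoat : coatomic L)
    (HIL : simple_local_IL L) (G : set (Fm L))
    (K : Type) (HK : inhabited K) (phi : K -> Fm L) :
  (antiadmissible G phi <->
     (forall D : set (Fm L),
        antitheorem (range phi `|` D) -> antitheorem (G `|` D)))
  /\
  (antiadmissible G phi <->
     (forall D : set (Fm L), simple_theory D ->
        antitheorem (range phi `|` D) -> antitheorem (G `|` D))).
Proof.
split; split.
- by move=> adm D; apply: antiadmissible_antitheorem.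
- move=> anti; apply: simple_antitheorem_antiadmissible => // D _.
  exact: anti.
- by move=> adm D _; apply: antiadmissible_antitheorem.
- exact: simple_antitheorem_antiadmissible.
Qed.
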